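(* Let $(\Omega,\mathcal F,(\mathcal F_t)_{t\in\mathbb N_0})$ be a filtered measurable space, $\mathcal P$ a family of probability measures on $(\Omega,\mathcal F)$, $Q$ a probability measure on $(\Omega,\mathcal F)$, and $I\in(0,\infty)$. Let $k_0\ge3$ be an integer and let $h:\{k_0,k_0+1,\dots\}\to(0,\infty)$ be nondecreasing with $h(k)=o(\log k)$ as $k\to\infty$ and $\sum_{k=k_0}^\infty \frac{e^{-h(k)}}{k}<\infty$. For $k\ge k_0$ define $$\alpha_k:=c_h\frac{e^{-h(k)}}{k},\qquad c_h:=\Big(\sum_{k=k_0}^\infty\frac{e^{-h(k)}}{k}\Big)^{-1}.$$ For each $k\ge k_0$ let $\tau_{\alpha_k}$ be an $(\mathcal F_t)$-stopping time with values in $\mathbb N_0\cup\{\infty\}$ such that $\sup_{P\in\mathcal P}P(\tau_{\alpha_k}<\infty)\le\alpha_k$, and define $$B^{(h)}_t:=\sum_{k=k_0}^\infty\mathbf 1_{\{\tau_{\alpha_k}\le t\}},\qquad t\in\mathbb N_0.$$ Assume that $\frac{\tau_{\alpha_k}}{\log(1/\alpha_k)}\to\frac1I$ $Q$-almost surely as $k\to\infty$. Then $B^{(h)}$ is a $\mathcal P$-$e$-process, and $Q$-almost surely as $t\to\infty$, $$\frac1t\log B^{(h)}_t\longrightarrow I.$$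
   Context: A nonnegative adapted process $M=(M_t)_{t\in\mathbb N_0}$ (values in $[0,\infty]$ allowed) is a $\mathcal P$-$e$-process if $\mathbb E_P[M_\sigma]\le1$ for every $P\in\mathcal P$ and every finite $(\mathcal F_t)$-stopping time $\sigma$. Conventions: $\mathbb N_0=\{0,1,2,\dots\}$, $\log0=-\infty$, $\log\infty=\infty$. *)

(* Defs.v *)
From HB Require Import structures.
From mathcomp Require Export all_boot all_order all_algebra.
From mathcomp Require Export all_classical all_reals all_analysis.
From mathcomp Require Export measurable_realfun.
Export Order.TTheory GRing.Theory Num.Theory.
Export numFieldNormedType.Exports.

Set Implicit Arguments.
Unset Strict Implicit.
Unset Printing Implicit Defensive.

Local Open Scope classical_set_scope.
Local Open Scope ring_scope.

Definition filtration d (T : measurableType d) (F : nat -> set (set T)) :=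
  [/\ forall t, sigma_algebra [set: T] (F t),
      forall t, F t `<=` measurable
    & forall s t : nat, (s <= t)%N -> F s `<=` F t].

(* Random times take values in [option nat], with [None] standing for oo. *)
Definition time_le (s : option nat) (t : nat) : bool :=
  if s is Some n then (n <= t)%N else false.

Definition time_ereal (R : realType) (s : option nat) : \bar R :=
  if s is Some n then n%:R%:E else +oo%E.

Definition stopping_time (T : Type) (F : nat -> set (set T))
    (tau : T -> option nat) :=
  forall t, F t [set w | time_le (tau w) t].

Definition adapted (R : realType) (T : Type) (F : nat -> set (set T))
    (M : nat -> T -> \bar R) :=
  forall (t : nat) (Y : set (\bar R)), measurable Y -> F t (M t @^-1` Y).

(* A finite stopping time is a stopping time with values in [nat]; [M] may take
   the value +oo, hence the extended-real integral for the expectation. *)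
Definition e_process (R : realType) d (T : measurableType d)
    (F : nat -> set (set T)) (PP : set (probability T R))
    (M : nat -> T -> \bar R) :=
  [/\ forall t w, (0 <= M t w)%E,
      adapted F M
    & forall P : probability T R, PP P ->
      forall sigma : T -> nat, stopping_time F (fun w => Some (sigma w)) ->
        (\int[P]_w M (sigma w) w <= 1)%E].

Definition weight (R : realType) (h : nat -> R) (k : nat) : R :=
  expR (- h k) / k%:R.

Definition normalizing_const (R : realType) (k0 : nat) (h : nat -> R) : R :=
  (limn (fun n => \sum_(k0 <= k < n) weight h k))^-1.

Definition level (R : realType) (k0 : nat) (h : nat -> R) (k : nat) : R :=
  normalizing_const k0 h * weight h k.

Definition count_process (R : realType) (T : Type) (k0 : nat)
    (tau : nat -> T -> option nat) (t : nat) (w : T) : \bar R :=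
  (\sum_(k0 <= k <oo) (\1_[set w' | time_le (tau k w') t] w : R)%:E)%E.

(* Main.v *)
Require Import Defs.
From mathcomp Require Import zify ring lra.

(* The levels [alpha_k] sum to 1, and at any finite time the count is at most
   the number of events [tau_k < oo], so a union bound gives the e-process
   property. For the growth rate, [h k = o(log k)] yields
   [log (1 / alpha_k) ~ log k], hence almost surely [tau_k ~ log k / I]. Thus
   for [a < I < b] and [t] large, all [k] between a fixed [K] and [exp (a t)]
   are counted at time [t], and no [k >= K] beyond [exp (b t)] is. *)

Set Implicit Arguments.
Unset Strict Implicit.
Unset Printing Implicit Defensive.

Local Open Scope classical_set_scope.
Local Open Scope ring_scope.

(** * Positivity and total mass of the levels *)

Section Levels.
Context {R : realType} (k0 : nat) (h : nat -> R).
Hypothesis k0_gt0 : (0 < k0)%N.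
Hypothesis summable : cvgn (fun n => \sum_(k0 <= k < n) weight h k).

Lemma weight_gt0 k : (0 < k)%N -> 0 < weight h k.
Proof. by move=> k_gt0; rewrite divr_gt0 ?expR_gt0 ?ltr0n. Qed.

Lemma normalizing_const_gt0 : 0 < normalizing_const k0 h.
Proof.
(* The partial sums are nondecreasing, so their limit is at least the first term [weight h k0],
   which is positive. *)
rewrite invr_gt0; apply: (lt_le_trans (weight_gt0 k0_gt0)).
have : \sum_(k0 <= k < k0.+1) weight h k <=
    limn (fun n => \sum_(k0 <= k < n) weight h k).
  apply: nondecreasing_cvgn_le => // m n mn; rewrite -subr_ge0.
  have [k0m|mk0] := leqP k0 m.
    rewrite (big_cat_nat k0m mn) /= addrAC subrr add0r big_nat.
    by apply: sumr_ge0 => k /andP[mk _]; rewrite ltW// weight_gt0//; lia.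
  rewrite [X in _ - X]big_geq ?(ltnW mk0)// subr0 big_nat.
  by apply: sumr_ge0 => k /andP[k0k _]; rewrite ltW// weight_gt0//; lia.
by rewrite big_nat1.
Qed.

Lemma level_gt0 k : (k0 <= k)%N -> 0 < level k0 h k.
Proof.
move=> k0k; rewrite mulr_gt0 ?normalizing_const_gt0// weight_gt0//; lia.
Qed.

Lemma sum_level : (\sum_(k0 <= k <oo) (level k0 h k)%:E = 1)%E.
Proof.
have c_gt0 := normalizing_const_gt0.
have cvg1 : \sum_(k0 <= k < n) level k0 h k @[n --> \oo] --> (1 : R).
  rewrite (_ : (fun _ => _) =
      (fun n => normalizing_const k0 h * \sum_(k0 <= k < n) weight h k)).
    rewrite -(@mulVf _ (limn (fun n => \sum_(k0 <= k < n) weight h k))).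
      exact: cvgMr.
    by rewrite -invr_eq0 gt_eqF.
  by apply/funext => n; rewrite mulr_sumr.
under eq_fun do rewrite sumEFin.
rewrite EFin_lim; last by apply/cvg_ex; exists 1.
by congr _%:E; exact: cvg_lim cvg1.
Qed.

End Levels.

(** * Adaptedness and the bound at finite stopping times *)

Section EProcess.
Context {R : realType} {d : measure_display} {T : measurableType d}.
Variables (F : nat -> set (set T)) (k0 : nat) (tau : nat -> T -> option nat).
Hypothesis F_filtration : filtration F.
Hypothesis tau_stopping : forall k, (k0 <= k)%N -> stopping_time F (tau k).

Lemma adapted_count_process : adapted F (count_process R k0 tau).
Proof.
have [F_sigma _ _] := F_filtration.
(* [F t] equals the sigma-algebra it generates, so adaptedness becomes measurability on
   [g_sigma_algebraType (F t)]. *)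
move=> t Y mY; rewrite -(measurable_g_measurableTypeE (F_sigma t)).
rewrite -[X in _ X]setTI.
suff : measurable_fun [set: g_sigma_algebraType (F t)]
    (count_process R k0 tau t) by apply.
rewrite /count_process.
under eq_fun do rewrite eseries_cond/=.
apply: ge0_emeasurable_sum => [k w _ _|k].
  by rewrite lee_fin.
move=> k0k.
apply/measurable_EFinP/measurable_indic.
by rewrite (measurable_g_measurableTypeE (F_sigma t)); exact: tau_stopping.
Qed.

Lemma measurable_time_le (rho : T -> option nat) t :
  stopping_time F rho -> measurable [set w | time_le (rho w) t].
Proof.
have [_ F_sub _] := F_filtration.
by move=> rhoF; apply: (F_sub t); exact: rhoF.
Qed.

Lemma measurable_stopping_lty (rho : T -> option nat) :
  stopping_time F rho -> measurable [set w | rho w <> None].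
Proof.
move=> rhoF.
rewrite (_ : [set _ | _] = \bigcup_t [set w | time_le (rho w) t]).
  by apply: bigcupT_measurable => t; exact: measurable_time_le.
apply/seteqP; split=> [w/=|w [t _]/=]; last by case: (rho w).
by case rwn: (rho w) => [n|]// _; exists n => //=; rewrite rwn /=.
Qed.

(** The event holds iff some [n] separates the two times, [rho <= n <= sigma]; here [n <= sigma] is
    the complement of the union of the events [sigma <= m] with [m < n]. *)
Lemma measurable_time_le_stopping (rho : T -> option nat) (sigma : T -> nat) :
  stopping_time F rho -> stopping_time F (fun w => Some (sigma w)) ->
  measurable [set w | time_le (rho w) (sigma w)].
Proof.
move=> rhoF sigmaF.
rewrite (_ : [set _ | _] = \bigcup_n ([set w | time_le (rho w) n] `\`
    \bigcup_(m < n) [set w | (sigma w <= m)%N])); last first.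
  apply/seteqP; split=> [w/= rw|w [n _]/= [rn sn]].
    by exists (sigma w) => //=; split => // -[m/= ms]; rewrite leqNgt ms.
  have ns : (n <= sigma w)%N.
    by rewrite leqNgt; apply/negP => sn'; apply: sn; exists (sigma w) => /=.
  by case: (rho w) rn => //= m /leq_trans; apply.
apply: bigcupT_measurable => n; apply: measurableD.
  exact: measurable_time_le.
by apply: bigcup_measurable => m _; exact: (measurable_time_le m sigmaF).
Qed.

(** Integrating termwise gives the sum of the probabilities of [tau k <= sigma]. As [sigma] is
    finite, each such event lies in [tau k < oo]. *)
Lemma integral_count_process_le (P : probability T R) (a : nat -> R)
    (sigma : T -> nat) :
  (forall k, (k0 <= k)%N -> (P [set w | tau k w <> None] <= (a k)%:E)%E) ->
  stopping_time F (fun w => Some (sigma w)) ->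
  (\int[P]_w count_process R k0 tau (sigma w) w <=
   \sum_(k0 <= k <oo) (a k)%:E)%E.
Proof.
move=> Pa sigmaF.
(* Below [k0], [tau k] need not be a stopping time; the empty set keeps every [E k] measurable and
   lets the series start at 0. *)
pose E k := if (k0 <= k)%N then [set w | time_le (tau k w) (sigma w)] else set0.
have mE k : measurable (E k).
  rewrite /E; case: ifPn => // k0k.
  exact: measurable_time_le_stopping (tau_stopping k0k) sigmaF.
rewrite (_ : (fun w => count_process R k0 tau (sigma w) w) =
    (fun w => \sum_(0 <= k <oo) (\1_(E k) w)%:E)%E); last first.
  apply/funext => w; rewrite /count_process eseries_cond eseries_mkcond.
  apply: eq_eseriesr => k _ /=; rewrite /E; case: ifPn => // _.
  by rewrite indic0.
rewrite integral_nneseries//; last first.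
  by move=> k; apply/measurable_EFinP/measurable_indic.
rewrite [leRHS]eseries_cond [leRHS]eseries_mkcond.
apply: lee_nneseries => [k _ _|k _]; first exact: integral_ge0.
rewrite integral_indic// setIT /E /=; case: ifPn => [k0k|_]; last first.
  by rewrite measure0.
apply: le_trans (Pa _ k0k); apply: le_measure; rewrite ?inE.
- exact: measurable_time_le_stopping (tau_stopping k0k) sigmaF.
- exact/measurable_stopping_lty/tau_stopping.
- by move=> w /=; case: (tau k w).
Qed.

End EProcess.

(** * Bounds on the count at a fixed time on a fixed path *)

Section Count.
Context {R : realType} {T : Type}.
Variables (k0 K : nat) (tau : nat -> T -> option nat) (t : nat) (w : T) (x : R).

Lemma truncn_exists : 0 <= x -> exists m : nat, m%:R <= x < m.+1%:R.
Proof. by move=> x_ge0; exists (Num.truncn x); exact: truncn_itv. Qed.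

(** With [m] the integer part of [x], a counted index is below [K] or at most [m]. Hence the tail
    from [k0 + (K + m.+1)] vanishes, and the [K + m.+1] earlier terms are at most 1 each. *)
Lemma count_process_ub :
  (forall k, (K <= k)%N -> time_le (tau k w) t -> k%:R <= x) -> 0 <= x ->
  (count_process R k0 tau t w <= (x + K.+1%:R)%:E)%E.
Proof.
move=> tauK /truncn_exists[m /andP[mx xm]].
rewrite /count_process (@nneseries_split _ _ _ (K + m.+1)); last first.
  by move=> k _; rewrite lee_fin.
rewrite [X in (_ + X)%E]eseries0; last first.
  move=> k Nk _; rewrite indicE memNset//= => tkt.
  have Kk : (K <= k)%N by lia.
  have := le_lt_trans (tauK k Kk tkt) xm; rewrite ltr_nat; lia.
rewrite adde0 sumEFin lee_fin.
apply: (@le_trans _ _ (\sum_(k0 <= k < k0 + (K + m.+1)) 1)).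
  by apply: ler_sum => k _; rewrite indicE; case: (_ \in _).
rewrite sumr_const_nat addKn natrD -natr1 -[X in _ <= _ + X]natr1; lra.
Qed.

(** With [m] the integer part of [x], each index from [K] to [m] contributes 1, and [m + 1 - K]
    exceeds [x - K]. If [x < K] the bound is negative. *)
Lemma count_process_lb : (k0 <= K)%N ->
  (forall k, (K <= k)%N -> k%:R <= x -> time_le (tau k w) t) -> 0 <= x ->
  ((x - K%:R)%:E <= count_process R k0 tau t w)%E.
Proof.
move=> k0K tauK /truncn_exists[m /andP[mx xm]].
have u_ge0 k : (0 <= (\1_[set w' | time_le (tau k w') t] w : R)%:E)%E.
  by rewrite lee_fin.
have [xK|Kx] := ltrP x K%:R.
  by apply: le_trans (nneseries_ge0 _) => //; rewrite lee_fin; lra.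
have KN : (K <= m.+1)%N by rewrite -(ler_nat R) (le_trans Kx)// ltW.
rewrite /count_process (@nneseries_split _ _ _ (m.+1 - k0))//.
apply: le_trans (leeDl _ (nneseries_ge0 _)) => //.
rewrite subnKC ?(leq_trans k0K)// sumEFin lee_fin.
rewrite (big_cat_nat k0K KN)/=; apply: ler_wpDl; first exact: sumr_ge0.
apply: (@le_trans _ _ (\sum_(K <= k < m.+1) 1)).
  by rewrite sumr_const_nat natrB//; lra.
rewrite !big_nat; apply: ler_sum => k /andP[Kk]; rewrite ltnS => km.
by rewrite indicE mem_set//=; apply: tauK => //; rewrite (le_trans _ mx)// ler_nat.
Qed.

End Count.

(** A larger exponential rate absorbs an additive constant: [expR (b t)] is at least
    [expR (a t) * (1 + (b - a) t)], hence at least [expR (a t) + (b - a) t], because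
    [expR (a t) >= 1]. *)
Lemma near_expR_gap {R : realType} (a b C : R) : 0 <= a -> a < b ->
  \forall t \near \oo, expR (a * t%:R) + C <= expR (b * t%:R).
Proof.
move=> a_ge0 ab; have ba_gt0 : 0 < b - a by rewrite subr_gt0.
near=> t.
have Ct : C <= (b - a) * t%:R.
  by rewrite mulrC -ler_pdivrMr//; near: t; exact: nbhs_infty_ger.
have -> : b * t%:R = a * t%:R + (b - a) * t%:R by ring.
rewrite expRD.
have e1 : 1 <= expR (a * t%:R).
  by apply: le_trans (expR_ge1Dx _); rewrite lerDl mulr_ge0.
have u_ge0 : 0 <= (b - a) * t%:R by rewrite mulr_ge0// ltW.
have := expR_ge1Dx ((b - a) * t%:R); nra.
Unshelve. all: by end_near. Qed.

(** * From the growth of [tau k] to the growth of the count *)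

Section Growth.
Context {R : realType} {T : Type}.
Variables (k0 : nat) (tau : nat -> T -> option nat) (w : T).

(** A division-free form of [1 / b <= tau k / ln k <= 1 / a], with finiteness of [tau k]
    included. *)
Definition eventually_between (a b : R) :=
  \forall k \near \oo, exists2 n : nat, tau k w = Some n &
    a * n%:R <= ln (k%:R : R) <= b * n%:R.

Lemma near_count_process_between (a a' b' b : R) :
  0 < a -> a < a' -> 0 < b' -> b' < b -> eventually_between a' b' ->
  \forall t \near \oo, ((expR (a * t%:R))%:E <= count_process R k0 tau t w <=
    (expR (b * t%:R))%:E)%E.
Proof.
move=> a_gt0 aa' b'_gt0 b'b [K0 _ tauK0].
(* Beyond [K] the bounds on [tau k] hold ([K0]), the index is part of the sum ([k0]), and [k > 0],
   so that [ln] inverts [expR] there. *)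
set K := maxn (maxn K0 k0) 1.
have tauK k : (K <= k)%N -> exists2 n : nat, tau k w = Some n &
    a' * n%:R <= ln (k%:R : R) <= b' * n%:R.
  by move=> Kk; apply: tauK0 => /=; lia.
near=> t; apply/andP; split.
- apply: (@le_trans _ _ (expR (a' * t%:R) - K%:R)%:E).
    by rewrite lee_fin lerBrDr; near: t; apply: near_expR_gap => //; lra.
  apply: count_process_lb => [|k Kk kx|]; [lia| |exact: expR_ge0].
  have [n -> /andP[ank _]] := tauK _ Kk.
  rewrite /= -(ler_nat R) -(@ler_pM2l _ a'); last lra.
  rewrite (le_trans ank)// -[leRHS]expRK ler_ln ?posrE ?expR_gt0//.
  by rewrite ltr0n; lia.
- apply: (@le_trans _ _ (expR (b' * t%:R) + K.+1%:R)%:E); last first.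
    by rewrite lee_fin; near: t; apply: near_expR_gap => //; lra.
  apply: count_process_ub; last exact: expR_ge0.
  move=> k Kk; have [n -> /andP[_ kbn]] /= := tauK _ Kk => nt.
  rewrite -(@lnK _ k%:R) ?posrE; last by rewrite ltr0n; lia.
  by rewrite ler_expR (le_trans kbn)// ler_pM2l// ler_nat.
Unshelve. all: by end_near. Qed.

Lemma cvg_lne_count_process (I : R) : 0 < I ->
  (forall a b : R, 0 < a -> a < I -> I < b -> eventually_between a b) ->
  ((1 / t%:R)%:E * lne (count_process R k0 tau t w))%E
    @[t --> \oo] --> I%:E.
Proof.
move=> I_gt0 tauI.
(* The condition [e < I] keeps the lower slope [I - e] positive; the equation with [r%:E] also
   records that the value is finite. *)
have key (e : R) : 0 < e -> e < I -> \forall t \near \oo,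
    exists2 r : R, `|I - r| <= e &
      ((1 / t%:R)%:E * lne (count_process R k0 tau t w))%E = r%:E.
  move=> e_gt0 eI; near=> t.
  have t_gt0 : (0 : R) < t%:R.
    by rewrite ltr0n; near: t; exact: nbhs_infty_gt.
  have : ((expR ((I - e) * t%:R))%:E <= count_process R k0 tau t w <=
      (expR ((I + e) * t%:R))%:E)%E.
    near: t.
    (* The half-way slopes [I - e / 2] and [I + e / 2] govern [tau]; the remaining [e / 2] on each
       side absorbs the constants. *)
    apply: (@near_count_process_between _ (I - e / 2) (I + e / 2));
      [lra..|apply: tauI; lra].
  case: (count_process R k0 tau t w) => [r| |]; rewrite ?lee_fin ?andbF//.
  move=> /andP[er re]; have r_gt0 := lt_le_trans (expR_gt0 _) er.
  exists (1 / t%:R * ln r); last by rewrite lne_EFin.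
  have lnr_ge : I - e <= ln r / t%:R.
    by rewrite ler_pdivlMr// -[leLHS]expRK ler_ln ?posrE ?expR_gt0.
  have lnr_le : ln r / t%:R <= I + e.
    by rewrite ler_pdivrMr// -[leRHS]expRK ler_ln ?posrE ?expR_gt0.
  by rewrite mul1r [_^-1 * _]mulrC distrC ler_distl lnr_le lnr_ge.
apply/fine_cvgP; split.
  have e0 : 0 < I / 2 by lra.
  have eI : I / 2 < I by lra.
  by apply: filterS (key _ e0 eI) => t [r _ ->].
apply/cvgrPdist_le => e e_gt0.
have e0 : 0 < Num.min e (I / 2) by rewrite lt_min e_gt0/=; lra.
have eI : Num.min e (I / 2) < I by rewrite gt_min; apply/orP; right; lra.
apply: filterS (key _ e0 eI) => t [r Ir /= ->].
by apply: le_trans Ir _; rewrite ge_min lexx.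
Unshelve. all: by end_near. Qed.

End Growth.

(** * Logarithms of the levels and the assumed rate *)

Lemma cvg_ln_nat (R : realType) : ln (k%:R : R) @[k --> \oo] --> +oo.
Proof.
apply/cvgryPge => A; near=> k.
rewrite -[A]expRK ler_ln ?posrE ?expR_gt0//.
  by near: k; exact: nbhs_infty_ger.
by rewrite ltr0n; near: k; exact: nbhs_infty_gt.
Unshelve. all: by end_near. Qed.

Section LogLevel.
Context {R : realType} (k0 : nat) (h : nat -> R).
Hypothesis k0_gt0 : (0 < k0)%N.
Hypothesis summable : cvgn (fun n => \sum_(k0 <= k < n) weight h k).
Hypothesis h_littleo : h =o_\oo (fun k : nat => ln (k%:R : R)).

Lemma ln_inv_level k : (k0 <= k)%N ->
  ln (1 / level k0 h k) = ln k%:R + h k - ln (normalizing_const k0 h).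
Proof.
move=> k0k; have k_gt0 : (0 < k)%N by lia.
have c_gt0 := normalizing_const_gt0 k0_gt0 summable.
rewrite div1r lnV ?posrE ?level_gt0// lnM ?posrE// ?weight_gt0//.
rewrite ln_div ?posrE ?expR_gt0 ?ltr0n// expRK; ring.
Qed.

(** The ratio differs from 1 by [(h k - c) / ln k], with [c] the logarithm of the normalizing
    constant; [h] and [c] each receive half of the tolerance. *)
Lemma cvg_ln_inv_level_ratio :
  ln (1 / level k0 h k) / ln k%:R @[k --> \oo] --> (1 : R).
Proof.
apply/cvgrPdist_le => e e_gt0.
have e2_gt0 : 0 < e / 2 by lra.
have /eqoP /(_ _ e2_gt0) h_small := h_littleo.
(* This threshold makes [|c|] at most [e / 2 * ln k]; the added 1 forces [ln k > 0]. *)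
have ln_large := (cvgryPge _).1 (@cvg_ln_nat R)
  (`|ln (normalizing_const k0 h)| / (e / 2) + 1).
near=> k.
have k0k : (k0 <= k)%N by near: k; exact: nbhs_infty_ge.
have lnk : `|ln (normalizing_const k0 h)| / (e / 2) + 1 <= ln (k%:R : R).
  by near: k; exact: ln_large.
have hk : `|h k| <= e / 2 * `|ln (k%:R : R)| by near: k; exact: h_small.
have lnk_gt0 : 0 < ln (k%:R : R).
  by apply: lt_le_trans lnk; rewrite ltr_wpDl// divr_ge0// ltW.
rewrite ln_inv_level//; move: hk lnk; rewrite (gtr0_norm lnk_gt0).
set c := ln (normalizing_const k0 h); set l := ln (k%:R : R) => hk lnk.
have cl : `|c| <= e / 2 * l.
  by rewrite mulrC -ler_pdivrMr// (le_trans _ lnk)// lerDl.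
rewrite (_ : 1 - _ = (c - h k) / l); last by field; rewrite gt_eqF.
rewrite normrM normfV (gtr0_norm lnk_gt0) ler_pdivrMr//.
apply: le_trans (ler_normB _ _) _.
by rewrite (_ : e * l = e / 2 * l + e / 2 * l) ?lerD//; field.
Unshelve. all: by end_near. Qed.

(** Multiplying the assumed rate by the previous ratio gives [tau k / ln k --> 1 / I], a limit
    strictly between [1 / b] and [1 / a]. *)
Lemma eventually_between_of_rate (T : Type) (tau : nat -> T -> option nat)
    (w : T) (I a b : R) : 0 < I ->
  (time_ereal R (tau k w) / (ln (1 / level k0 h k))%:E)%E
    @[k --> \oo] --> (1 / I)%:E ->
  0 < a -> a < I -> I < b -> eventually_between tau w a b.
Proof.
move=> I_gt0 /fine_cvgP[fin_rate cvg_rate] a_gt0 aI Ib.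
have : fine (time_ereal R (tau k w) / (ln (1 / level k0 h k))%:E)%E *
    (ln (1 / level k0 h k) / ln k%:R) @[k --> \oo] --> 1 / I.
  by rewrite -[X in _ --> X]mulr1; exact: cvgM cvg_rate cvg_ln_inv_level_ratio.
move=> cvg_ratio.
have lt_a : 1 / I < 1 / a by rewrite !div1r ltf_pV2.
have gt_b : 1 / b < 1 / I by rewrite !div1r ltf_pV2// posrE; lra.
have ratio_lt := cvgr_lt _ cvg_ratio _ lt_a.
have ratio_gt := cvgr_gt _ cvg_ratio _ gt_b.
have ratio_gt0 := cvgr_gt _ cvg_ln_inv_level_ratio _ (ltr01 : 0 < 1).
rewrite /eventually_between.
near=> k.
have lnk_gt0 : 0 < ln (k%:R : R).
  by near: k; apply: filterS ((cvgryPge _).1 (@cvg_ln_nat R) 1) => k; lra.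
have ratioL : 0 < ln (1 / level k0 h k) / ln (k%:R : R) by near: k; exact: ratio_gt0.
have : (time_ereal R (tau k w) / (ln (1 / level k0 h k))%:E)%E \is a fin_num.
  by near: k; exact: fin_rate.
have : fine (time_ereal R (tau k w) / (ln (1 / level k0 h k))%:E)%E *
    (ln (1 / level k0 h k) / ln (k%:R : R)) < 1 / a.
  by near: k; exact: ratio_lt.
have : 1 / b < fine (time_ereal R (tau k w) / (ln (1 / level k0 h k))%:E)%E *
    (ln (1 / level k0 h k) / ln (k%:R : R)).
  by near: k; exact: ratio_gt.
move: ratioL; rewrite pmulr_lgt0 ?invr_gt0//.
set L := ln (1 / level k0 h k) => Lk_gt0.
have b_gt0 : 0 < b by lra.
(* An infinite [tau k] is excluded: since [L > 0], the quotient would be [+oo], contrary to its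
   eventual finiteness. *)
rewrite inver gt_eqF//; case: (tau k w) => [n|] /=; last first.
  by rewrite mulyr sgrV gtr0_sg// mul1e.
rewrite (_ : n%:R * L^-1 * (L / ln k%:R) = n%:R / ln (k%:R : R)); last first.
  by field; rewrite !gt_eqF.
rewrite !div1r ltr_pdivlMr// [b^-1 * _]mulrC ltr_pdivrMr// => lb.
rewrite ltr_pdivrMr// [a^-1 * _]mulrC ltr_pdivlMr// => la _.
by exists n => //; rewrite ![_ * n%:R]mulrC !ltW.
Unshelve. all: by end_near. Qed.

End LogLevel.

(* [tau k] stands for $\tau_{\alpha_k}$; values of [h] and [tau] below [k0] are
   unconstrained and unused. *)
Theorem proposition4p4 (R : realType) (d : measure_display)
    (T : measurableType d) (F : nat -> set (set T))
    (PP : set (probability T R)) (Q : probability T R) (I : R)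
    (k0 : nat) (h : nat -> R) (tau : nat -> T -> option nat)
    (F_filtration : filtration F)
    (I_gt0 : 0 < I)
    (k0_ge3 : (3 <= k0)%N)
    (h_gt0 : forall k, (k0 <= k)%N -> 0 < h k)
    (h_nondecreasing :
      forall k l, (k0 <= k)%N -> (k <= l)%N -> h k <= h l)
    (h_littleo : h =o_\oo (fun k : nat => ln (k%:R : R)))
    (weight_summable : cvgn (fun n => \sum_(k0 <= k < n) weight h k))
    (tau_stopping : forall k, (k0 <= k)%N -> stopping_time F (tau k))
    (tau_level : forall k, (k0 <= k)%N ->
      (ereal_sup [set (P : set T -> \bar R) [set w | tau k w <> None] | P in PP]
        <= (level k0 h k)%:E)%E)
    (tau_rate : {ae Q, forall w,
      (time_ereal R (tau k w) / (ln (1 / level k0 h k))%:E)%E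
        @[k --> \oo] --> (1 / I)%:E}) :
  e_process F PP (count_process R k0 tau) /\
  {ae Q, forall w,
    ((1 / t%:R)%:E * lne (count_process R k0 tau t w))%E
      @[t --> \oo] --> I%:E}.
Proof.
have k0_gt0 : (0 < k0)%N by lia.
split; last first.
  (* The growth claim is deterministic on each path where the rate holds. *)
  apply: filterS tau_rate => w rate_w; apply: cvg_lne_count_process => // a b.
  exact: eventually_between_of_rate rate_w.
split.
- by move=> t w; apply: nneseries_ge0 => k _ _; rewrite lee_fin.
- exact: adapted_count_process.
- move=> P PP_P sigma sigmaF.
  (* The bound 1 is the total mass of the levels. *)
  rewrite -(sum_level k0_gt0 weight_summable).
  apply: (integral_count_process_le F_filtration) => // k k0k.
  by apply: le_trans (tau_level k k0k); apply: ereal_sup_ubound; exists P.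
Qed.
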